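(* For every integer $n \geq 6$, $$\gamma_{b,2}(C_6 \square C_n) = n + \begin{cases} 0 & \text{if } n \equiv 0 \pmod 4,\\ 1 & \text{if } n \equiv 1, 2, \text{ or } 3 \pmod 4.\end{cases}$$
   Context: For a graph $G$, a $2$-limited broadcast is a function $f: V(G) \to \{0,1,2\}$. A vertex $u$ hears the broadcast from $v$ if $f(v) > 0$ and $d(u,v) \leq f(v)$, where $d$ is the distance in $G$. The broadcast $f$ is dominating if every vertex of $G$ hears the broadcast from some vertex. The cost of $f$ is $\sum_{v \in V(G)} f(v)$. The $2$-limited broadcast domination number $\gamma_{b,2}(G)$ is the minimum cost of a $2$-limited dominating broadcast on $G$. $C_n$ denotes the cycle on $n$ vertices and $\square$ the Cartesian product of graphs. *)

(* Defs.v *)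
From mathcomp Require Import all_boot all_order.
Set Implicit Arguments. Unset Strict Implicit. Unset Printing Implicit Defensive.

Fixpoint ball (V : finType) (e : rel V) (k : nat) (v : V) : {set V} :=
  match k with
  | 0 => [set v]
  | k'.+1 => ball e k' v :|: [set u | [exists w in ball e k' v, e w u]]
  end.

Definition dist_le (V : finType) (e : rel V) (u v : V) (k : nat) : bool :=
  u \in ball e k v.

Definition broadcast2 (V : finType) := {ffun V -> 'I_3}.

Definition hears (V : finType) (e : rel V) (f : broadcast2 V) (u v : V) : bool :=
  (0 < f v) && dist_le e u v (f v).

Definition dominating2 (V : finType) (e : rel V) (f : broadcast2 V) : bool :=
  [forall u, exists v, hears e f u v].

Definition bcost (V : finType) (f : broadcast2 V) : nat := \sum_(v : V) (f v : nat).

(* gamma_{b,2}: minimum cost of a dominating 2-limited broadcast.  The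
   default 2*|V| of the min-fold is harmless: the constant-1 broadcast is
   dominating with cost |V| <= 2*|V|. *)
Definition gamma_b2 (V : finType) (e : rel V) : nat :=
  \big[minn/(2 * #|V|)]_(f : broadcast2 V | dominating2 e f) bcost f.

Definition cycle_rel (n : nat) : rel 'I_n :=
  fun i j => (j == (i.+1 %% n) :> nat) || (i == (j.+1 %% n) :> nat).

Definition cart_rel (A B : finType) (eA : rel A) (eB : rel B) : rel (A * B) :=
  fun x y => ((x.1 == y.1) && eB x.2 y.2) || ((x.2 == y.2) && eA x.1 y.1).
Arguments cycle_rel n : clear implicits.

(* Main.v *)
Require Import Defs.
From mathcomp Require Import all_boot all_order.
From mathcomp Require Import zify.
Set Implicit Arguments. Unset Strict Implicit. Unset Printing Implicit Defensive.

(* Lower bound: a column of cost [c] covers at most [3c] vertices of itself,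
   [floor(3c/2)] of each adjacent column and [floor(c/2)] of each column at
   distance two. So the periodic sequence of column costs satisfies
   [c0/2 + 3c1/2 + 3c2 + 3c3/2 + c4/2 >= 6] (rounded down termwise) on every five
   consecutive columns. A potential on quadruples of consecutive costs shows that
   these inequalities alone force a mean of at least 1, with equality only for
   the sequence 0, 2, 0, 2, ... In that case each zero column forces the
   three rows heard from its left neighbour and the three heard from its right
   neighbour to be complementary, so the pattern of rows has period 4 exactly.
   Upper bound: repeat the four columns [2 in row 0, empty, 2 in row 3, empty],
   with a modified tail of 4 to 7 columns chosen by [n mod 4]. *)

(** * Balls in products and cycles *)

Section Balls.
Variables (V : finType) (e : rel V).

Lemma ballS k (v : V) u :
  reflect (u \in ball e k v \/ exists2 w, w \in ball e k v & e w u)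
          (u \in ball e k.+1 v).
Proof.
rewrite /= !inE; apply: (iffP orP) => -[Hu|Hu]; [by left| |by left|].
  by move/exists_inP: Hu; right.
by right; apply/exists_inP.
Qed.

Lemma ball_sub k l (v : V) : k <= l -> ball e k v \subset ball e l v.
Proof.
move=> /subnKC <-; elim: (l - k) => [|m IHm]; first by rewrite addn0.
by rewrite addnS; apply: subset_trans IHm (subsetUl _ _).
Qed.

End Balls.

Section CartBalls.
Variables (A B : finType) (eA : rel A) (eB : rel B).

(** A walk may make all its moves in the second coordinate first, so the induction on [b] sits in
    the base case of the one on [a]. *)
Lemma ball_cart a b (v1 u1 : A) (v2 u2 : B) :
  u1 \in ball eA a v1 -> u2 \in ball eB b v2 ->
  (u1, u2) \in ball (cart_rel eA eB) (a + b) (v1, v2).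
Proof.
elim: a u1 => [|a IHa] u1.
  rewrite inE add0n => /eqP->; elim: b u2 => [|b IHb] u2.
    by rewrite !inE => /eqP->.
  case/ballS=> [/IHb H|[w /IHb H ew]]; apply/ballS; first by left.
  by right; exists (v1, w) => //; rewrite /cart_rel /= eqxx ew.
case/ballS=> [Ha|[w Ha ew]] Hb; rewrite addSn; apply/ballS.
  by left; apply: IHa.
by right; exists (w, u2); [apply: IHa | rewrite /cart_rel /= eqxx ew orbT].
Qed.

(** Each step of a walk moves one coordinate; a step that stays put is charged to the first, which
    keeps [a + b = k] exact. *)
Lemma ball_cart_inv k (v u : A * B) :
  u \in ball (cart_rel eA eB) k v ->
  exists a b, [/\ a + b = k, u.1 \in ball eA a v.1 & u.2 \in ball eB b v.2].
Proof.
elim: k u => [|k IHk] u.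
  by rewrite inE => /eqP->; exists 0, 0; split; rewrite ?inE.
case/ballS=> [/IHk[a [b [<- Ha Hb]]]|[w /IHk[a [b [<- Ha Hb]]]]].
  by exists a.+1, b; split=> //; apply/ballS; left.
case/orP=> /andP[/eqP wu ew].
  exists a, b.+1; rewrite addnS -wu; split=> //.
  by apply/ballS; right; exists w.2.
exists a.+1, b; rewrite addSn -wu; split=> //.
by apply/ballS; right; exists w.1.
Qed.

End CartBalls.

Section CycleBalls.
Variable n : nat.
Hypothesis n_gt0 : 0 < n.

Definition modord (j : nat) : 'I_n := Ordinal (ltn_pmod j n_gt0).

Lemma modord_val (j : 'I_n) : modord j = j.
Proof. by apply: val_inj; rewrite /= modn_small. Qed.

Lemma modordE j k : j = k %[mod n] -> modord j = modord k.
Proof. by move=> H; apply: val_inj. Qed.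

(* The signed offset [u - v] in [-k, k] is encoded as [d - k]. *)
Lemma ball_cycleP k (v u : 'I_n) :
  reflect (exists2 d, d <= 2 * k & u + k = v + d %[mod n])
          (u \in ball (cycle_rel n) k v).
Proof.
elim: k u => [|k IHk] u.
  rewrite inE; apply: (iffP eqP) => [->|[d]]; first by exists 0.
  rewrite leqn0 => /eqP-> /eqP; rewrite !addn0 !modn_small // => /eqP.
  exact: val_inj.
apply: (iffP (ballS _ _ _ _)) => [[/IHk[d dk E]|[w /IHk[d dk E]]]|[d dk E]].
- exists d.+1; first lia.
  by rewrite !addnS -addn1 -[(v + d).+1]addn1 -modnDml E modnDml.
- case/orP=> /eqP Ew.
    exists d.+2; first lia.
    have ->: v + d.+2 = v + d + 2 by lia.
    rewrite Ew modnDml; have ->: w.+1 + k.+1 = w + k + 2 by lia.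
    by rewrite -modnDml E modnDml.
  exists d; first lia.
  by rewrite -E Ew modnDml addSnnS.
(* At the lowest offset [u] is reached from [u + 1]; at the next it already lies in the smaller
   ball; beyond that it is reached from [u - 1]. *)
case: d => [|[|d]] in dk E *.
- right; exists (modord u.+1).
    by apply/IHk; exists 0; rewrite //= modnDml addSnnS.
  by rewrite /cycle_rel /= eqxx orbT.
- left; apply/IHk; exists 0 => //.
  by apply/eqP; rewrite -(eqn_modDr 1) addn0 -addnA !addn1 E addn1.
right; exists (modord (u + n.-1)).
  apply/IHk; exists d; first lia.
  apply/eqP; rewrite modnDml -(eqn_modDr 2).
  have ->: u + n.-1 + k + 2 = u + k.+1 + n by lia.
  by rewrite modnDr E -addnA addn2.
rewrite /cycle_rel /= -addn1 modnDml.
have ->: u + n.-1 + 1 = u + n by lia.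
by rewrite modnDr modn_small // eqxx.
Qed.

Lemma card_ball_cycle k (v : 'I_n) : #|ball (cycle_rel n) k v| <= (2 * k).+1.
Proof.
rewrite -[(2 * k).+1]card_ord.
(* Adding [k * n.-1] subtracts [k] modulo [n]. *)
apply: leq_trans (leq_imset_card (fun d : 'I_(2 * k).+1 =>
  modord (v + d + k * n.-1)) _).
apply/subset_leq_card/subsetP => u /ball_cycleP[d dk E].
apply/imsetP; exists (inord d) => //; apply: val_inj => /=.
rewrite inordK // -modnDml -E modnDml -addnA.
by rewrite -mulnS prednK // addnC modnMDl modn_small.
Qed.

End CycleBalls.

(** * Periodic sequences of column costs *)

(* Column costs are capped at 6. A column of cost at least 6 is assumed to
   cover everything at distance two, so capping keeps windows feasible. *)
Definition capped2 x := if x < 6 then x./2 else 6.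

(** The three middle terms exceed 6 by themselves at the cap; only the outer ones are adjusted. *)
Definition feasible x0 x1 x2 x3 x4 :=
  6 <= capped2 x0 + (3 * x1)./2 + 3 * x2 + (3 * x3)./2 + capped2 x4.

Definition alternating x0 x1 x2 x3 x4 :=
  [:: x0; x1; x2; x3; x4] \in [:: [:: 0; 2; 0; 2; 0]; [:: 2; 0; 2; 0; 2]].

Definition lookup (D : seq (seq (seq (seq nat)))) x0 x1 x2 x3 :=
  nth 0 (nth [::] (nth [::] (nth [::] D x0) x1) x2) x3.

(* One Bellman-Ford step, in truncated natural numbers, for the longest walks in
   the graph of feasible windows, where a window weighs 12 (1 - x4), plus 1
   unless it is alternating. The factor 12 is large enough that no cycle has
   positive weight, and 16 steps reach the fixpoint. *)
Definition relax D :=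
  mkseq (fun x1 => mkseq (fun x2 => mkseq (fun x3 => mkseq (fun x4 =>
    foldr maxn 0 [seq if feasible x0 x1 x2 x3 x4
      then lookup D x0 x1 x2 x3 + 12 + ~~ alternating x0 x1 x2 x3 x4 - 12 * x4
      else 0 | x0 <- iota 0 7]) 7) 7) 7) 7.

Definition potential_table := iter 16 relax [::].
Definition potential := lookup potential_table.

(** Convergence of the iteration is checked by evaluation on all 7^5 windows. *)
Lemma potential_tableP :
  all (fun x0 => all (fun x1 => all (fun x2 => all (fun x3 => all (fun x4 =>
    feasible x0 x1 x2 x3 x4 ==>
    (potential x0 x1 x2 x3 + 12 + ~~ alternating x0 x1 x2 x3 x4
       <= potential x1 x2 x3 x4 + 12 * x4))
  (iota 0 7)) (iota 0 7)) (iota 0 7)) (iota 0 7)) (iota 0 7).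
Proof. by vm_compute. Qed.

Lemma potentialP x0 x1 x2 x3 x4 :
  x0 <= 6 -> x1 <= 6 -> x2 <= 6 -> x3 <= 6 -> x4 <= 6 ->
  feasible x0 x1 x2 x3 x4 ->
  potential x0 x1 x2 x3 + 12 + ~~ alternating x0 x1 x2 x3 x4
    <= potential x1 x2 x3 x4 + 12 * x4.
Proof.
have rg x : x <= 6 -> x \in iota 0 7 by rewrite mem_iota.
move=> /rg h0 /rg h1 /rg h2 /rg h3 /rg h4.
move: potential_tableP.
by move=> /allP/(_ _ h0)/allP/(_ _ h1)/allP/(_ _ h2)/allP/(_ _ h3)/allP
  /(_ _ h4)/implyP.
Qed.

Lemma sum_periodic_shift n (g : nat -> nat) k :
  (forall j, g (j + n) = g j) -> \sum_(j < n) g (j + k) = \sum_(j < n) g j.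
Proof.
move=> per; elim: k => [|k IHk]; first by under eq_bigr do rewrite addn0.
rewrite -IHk; case: n per {IHk} => [|n] per; first by rewrite !big_ord0.
rewrite big_ord_recr [RHS]big_ord_recl /= addnC; congr (_ + _).
  by rewrite addnS -addSn addnC per.
by apply: eq_bigr => i _; rewrite /bump /= add1n addSnnS.
Qed.

Section PeriodicCosts.
Variables (n : nat) (c : nat -> nat).
Hypothesis n_gt0 : 0 < n.
Hypothesis c_per : forall j, c (j + n) = c j.
Hypothesis c_cover : forall j,
  6 <= (c j)./2 + (3 * c j.+1)./2 + 3 * c j.+2 + (3 * c j.+3)./2 + (c j.+4)./2.

Let x j := minn (c j) 6.
Let alt j := alternating (x j) (x j.+1) (x j.+2) (x j.+3) (x j.+4).

Let x_feasible j : feasible (x j) (x j.+1) (x j.+2) (x j.+3) (x j.+4).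
Proof.
have capE m : capped2 (minn m 6) = if m < 6 then m./2 else 6.
  by rewrite /capped2 /minn; case: (ltnP m 6) => //= ->.
move: (c_cover j); rewrite /feasible /x !capE /minn.
case: (ltnP (c j)) => ?; case: (ltnP (c j.+1)) => ?; case: (ltnP (c j.+2)) => ?;
  case: (ltnP (c j.+3)) => ?; case: (ltnP (c j.+4)) => ?; lia.
Qed.

(** Summed over a period, the potentials cancel, and each non-alternating window leaves an excess of
    1. *)
Let sum_bound : 12 * n + \sum_(j < n) ~~ alt j <= 12 * \sum_(j < n) c j.
Proof.
pose phi j := potential (x j) (x j.+1) (x j.+2) (x j.+3).
have xper j : x (j + n) = x j by rewrite /x c_per.
have phiper j : phi (j + n) = phi j.
  by rewrite /phi -!addSn !xper.
have step j : phi j + 12 + ~~ alt j <= phi (j + 1) + 12 * c (j + 4).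
  rewrite addn1 addn4; apply: leq_trans (potentialP _ _ _ _ _ (x_feasible j)) _;
    rewrite ?geq_minr //.
  by rewrite leq_add2l leq_mul2l geq_minl orbT.
have : \sum_(j < n) (phi j + 12 + ~~ alt j)
    <= \sum_(j < n) (phi (j + 1) + 12 * c (j + 4)).
  by apply: leq_sum => j _; apply: step.
rewrite 3!big_split /= sum_nat_const card_ord -big_distrr /=.
rewrite (sum_periodic_shift _ phiper) (sum_periodic_shift _ c_per).
by rewrite -addnA leq_add2l mulnC.
Qed.

Lemma periodic_cost_ge : n <= \sum_(j < n) c j.
Proof. have := sum_bound; lia. Qed.

Lemma periodic_cost_eq j :
  \sum_(j < n) c j = n -> (c j = 0 \/ c j = 2) /\ c j + c j.+1 = 2.
Proof.
move=> sumE; have := sum_bound; rewrite sumE -{2}[12 * n]addn0 leq_add2l leqn0.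
rewrite sum_nat_eq0 => /forallP alt0.
(* The sum controls only windows starting below [n]; periodicity transfers this to every [j]. *)
have {alt0} : alt j.
  have xmod k : x (k %% n) = x k.
    rewrite /x {2}(divn_eq k n) addnC.
    by elim: (k %/ n) => [|q IH]; rewrite ?addn0 // mulSn addnCA addnC c_per.
  have altper k q : alt (k + q * n) = alt k.
    elim: q => [|q IH]; rewrite ?addn0 // mulSnr addnA -{}IH /alt -!addSn /x.
    by rewrite !c_per.
  rewrite {1}(divn_eq j n) addnC altper.
  by have /= := alt0 (modord n_gt0 j); rewrite eqb0 negbK.
rewrite /alt /alternating /x !inE => /orP[] /eqP[]; lia.
Qed.

End PeriodicCosts.

(** * Lower bound *)

Lemma card_bigcup_leq (I T : finType) (P : pred I) (F : I -> {set T}) :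
  #|\bigcup_(i | P i) F i| <= \sum_(i | P i) #|F i|.
Proof.
apply: (big_rec2 (fun (A : {set T}) m => #|A| <= m)) => [|i m A _ Am].
  by rewrite cards0.
by apply: leq_trans (leq_card_setU _ _) _; rewrite leq_add2l.
Qed.

Section Columns.
Variable n : nat.
Hypothesis n_gt1 : 1 < n.
Let n_gt0 : 0 < n := ltnW n_gt1.
Let colord := modord n_gt0.
Variable f : broadcast2 ('I_6 * 'I_n)%type.
Let G := cart_rel (cycle_rel 6) (cycle_rel n).

(* The rows in which a column at distance [d] from column [j] hears [j]. *)
Definition heard d j : {set 'I_6} :=
  \bigcup_(i | (0 < f (i, colord j)) && (d <= f (i, colord j)))
    ball (cycle_rel 6) (f (i, colord j) - d) i.

Definition column_cost j := \sum_i (f (i, colord j) : nat).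

Lemma heard_sub d d' j : d <= d' -> heard d' j \subset heard d j.
Proof.
move=> dd; apply/bigcupsP => i /andP[f0 fd].
have fd' := leq_trans dd fd.
apply/subsetP=> r /(subsetP (ball_sub _ _ (leq_sub2l _ dd))) ri.
by apply/bigcupP; exists i; rewrite ?f0.
Qed.

(* Column [j + i] is at signed offset [i - 2] from the central column [j + 2]
   of a window; truncated subtraction makes [(2 - i) + (i - 2)] the absolute
   value of that offset. *)
Lemma dominating_heardP :
  reflect (forall j r, exists2 i, i < 5 & r \in heard ((2 - i) + (i - 2)) (j + i))
          (dominating2 G f).
Proof.
apply: (iffP forallP) => [dom j r|dom [r c]].
  have /existsP[[i v]] := dom (r, colord (j + 2)).
  case/andP=> f0 /ball_cart_inv[a [b /= [ab]]].
  move=> ra /(ball_cycleP n_gt0)[d db]; rewrite modnDml => E.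
  have b2 : b <= 2.
    by rewrite -ltnS; apply: leq_ltn_trans (ltn_ord (f (i, v))); rewrite -ab leq_addl.
  (* The centre [j + 2] is at offset [d - b] from [v]; since [d <= 2 * b] and [b <= 2], the
     subtraction does not truncate. *)
  have jv : colord (j + (2 + b - d)) = v.
    rewrite -[v](modord_val n_gt0); apply: modordE.
    apply/eqP; rewrite -(eqn_modDr d) -E; apply/eqP; congr (_ %% _).
    by clear -db b2; lia.
  exists (2 + b - d); first lia.
  apply/bigcupP; exists i; rewrite jv.
    by rewrite f0 -ab; clear -db b2; lia.
  by apply: (subsetP (ball_sub _ _ _)) ra; rewrite -ab; clear -db b2; lia.
(* The window centred at [c]; adding [n] avoids truncation. *)
have [i i5 /bigcupP[p /andP[f0 fd]] rp] := dom (c + n - 2) r.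
apply/existsP; exists (p, colord (c + n - 2 + i)); rewrite /hears f0 /dist_le /=.
rewrite -{1}(subnK fd); apply: ball_cart => //; apply/(ball_cycleP n_gt0).
(* This encodes the signed offset [2 - i] for radius [(2 - i) + (i - 2)]; it is 0 when [i >= 2]. *)
exists (2 * (2 - i)); first lia.
rewrite /= modnDml.
have -> : c + n - 2 + i + 2 * (2 - i) = c + (2 - i + (i - 2)) + n by lia.
by rewrite modnDr.
Qed.

Lemma card_heard d j :
  #|heard d j| <= \sum_i
    if (0 < f (i, colord j)) && (d <= f (i, colord j))
    then (2 * (f (i, colord j) - d)).+1 else 0.
Proof.
rewrite -big_mkcond; apply: leq_trans (card_bigcup_leq _ _) _.
by apply: leq_sum => i _; apply: card_ball_cycle.
Qed.

(** Values 1 and 2 are heard in 3 and 5 rows of their own column, in 1 and 3 of an adjacent one, in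
    0 and 1 at distance two: at most 3, 3/2 and 1/2 per unit of cost. *)
Lemma card_heard0 j : #|heard 0 j| <= 3 * column_cost j.
Proof.
apply: leq_trans (card_heard 0 j) _; rewrite big_distrr /=.
by apply: leq_sum => i _; case: (f _) => [[|[|[|m]]] hm].
Qed.

Lemma card_heard1 j : #|heard 1 j| <= (3 * column_cost j)./2.
Proof.
rewrite geq_half_double -mul2n.
apply: leq_trans (leq_mul (leqnn 2) (card_heard 1 j)) _.
rewrite !big_distrr /=.
by apply: leq_sum => i _; case: (f _) => [[|[|[|m]]] hm].
Qed.

Lemma card_heard2 j : #|heard 2 j| <= (column_cost j)./2.
Proof.
rewrite geq_half_double -mul2n.
apply: leq_trans (leq_mul (leqnn 2) (card_heard 2 j)) _.
rewrite !big_distrr /=.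
by apply: leq_sum => i _; case: (f _) => [[|[|[|m]]] hm].
Qed.

Lemma colordDn j : colord (j + n) = colord j.
Proof. by apply: modordE; rewrite modnDr. Qed.

Lemma column_costDn j : column_cost (j + n) = column_cost j.
Proof. by rewrite /column_cost colordDn. Qed.

Lemma heardDn d j : heard d (j + n) = heard d j.
Proof. by rewrite /heard colordDn. Qed.

Lemma bcostE : bcost f = \sum_(j < n) column_cost j.
Proof.
rewrite /bcost /column_cost exchange_big pair_big /=.
by apply: eq_bigr => -[i j] _ /=; rewrite /colord modord_val.
Qed.

Hypothesis dom_f : dominating2 G f.

Lemma window_cover j : [set: 'I_6] \subset
  heard 2 j :|: heard 1 j.+1 :|: heard 0 j.+2 :|: heard 1 j.+3 :|: heard 2 j.+4.
Proof.
apply/subsetP => r _; have [i i5] := elimT dominating_heardP dom_f j r.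
rewrite !inE; case: i i5 => [|[|[|[|[|//]]]]] _ /=;
  by rewrite ?addn0 ?addn1 ?addn2 ?addn3 ?addn4 => ->; rewrite ?orbT.
Qed.

Lemma window_cost j : let c := column_cost in
  6 <= (c j)./2 + (3 * c j.+1)./2 + 3 * c j.+2 + (3 * c j.+3)./2 + (c j.+4)./2.
Proof.
rewrite /= -[6]card_ord -cardsT.
apply: leq_trans (subset_leq_card (window_cover j)) _.
do ![exact: card_heard0 | exact: card_heard1 | exact: card_heard2
   | apply: leq_trans (leq_card_setU _ _) _; apply: leq_add].
Qed.

Lemma heard_eq0 d j : column_cost j = 0 -> heard d j = set0.
Proof.
move=> c0; apply/eqP; rewrite -subset0 (subset_trans (heard_sub j (leq0n d))) //.
by rewrite subset0 -cards_eq0 -leqn0 (leq_trans (card_heard0 j)) // c0.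
Qed.

(** Two sets of at most three rows cover all six, so they cannot overlap. *)
Lemma heard1_complement j : column_cost j = 0 -> column_cost j.+1 = 2 ->
  column_cost j.+2 = 0 -> column_cost j.+3 = 2 -> column_cost j.+4 = 0 ->
  heard 1 j.+3 = ~: heard 1 j.+1.
Proof.
move=> c0 c1 c2 c3 c4; apply/esym/eqP; rewrite eqEcard; apply/andP; split.
  have := window_cover j.
  rewrite (heard_eq0 _ c0) (heard_eq0 _ c2) (heard_eq0 _ c4) set0U !setU0 => cov.
  by apply/subsetP=> r; rewrite inE => /negPf r1;
    have := subsetP cov r (in_setT r); rewrite inE r1.
rewrite -(leq_add2l #|heard 1 j.+1|) cardsC card_ord.
by have := leq_add (card_heard1 j.+1) (card_heard1 j.+3); rewrite c1 c3.
Qed.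

Lemma bcost_eq : bcost f = n -> n %% 4 = 0.
Proof.
rewrite bcostE => sumE.
have alt j := periodic_cost_eq n_gt0 column_costDn window_cost j sumE.
have [j0 c0] : exists j, column_cost j = 0.
  case: (alt 0) => -[c0|c2] /= c01; first by exists 0.
  by exists 1; lia.
have alt2 k : column_cost (j0 + 2 * k) = 0 /\ column_cost (j0 + 2 * k).+1 = 2.
  elim: k => [|k [IH0 IH1]].
    by rewrite addn0; have [_] := alt j0; rewrite c0.
  have -> : j0 + 2 * k.+1 = (j0 + 2 * k).+2 by lia.
  have [_] := alt (j0 + 2 * k).+1; have [_] := alt (j0 + 2 * k).+2; lia.
have flip k : heard 1 (j0 + 2 * k.+1).+1 = ~: heard 1 (j0 + 2 * k).+1.
  have -> : (j0 + 2 * k.+1).+1 = (j0 + 2 * k).+3 by lia.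
  have [a0 a1] := alt2 k; have [b0 b1] := alt2 k.+1; have [d0 _] := alt2 k.+2.
  apply: heard1_complement => //.
  - by have -> : (j0 + 2 * k).+2 = j0 + 2 * k.+1 by lia.
  - by have -> : (j0 + 2 * k).+3 = (j0 + 2 * k.+1).+1 by lia.
  - by have -> : (j0 + 2 * k).+4 = j0 + 2 * k.+2 by lia.
have flips k : heard 1 (j0 + 2 * k).+1 =
    if odd k then ~: heard 1 j0.+1 else heard 1 j0.+1.
  elim: k => [|k IHk]; first by rewrite addn0.
  by rewrite flip IHk /=; case: (odd k); rewrite //= setCK.
(* After one lap, an odd [n] would put cost 2 on the zero column [j0], and an odd [n./2] would make
   a set its own complement. *)
have nE := odd_double_half n; case odd_n: (odd n) nE => /= nE.
  have [_] := alt2 n./2.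
  have -> : (j0 + 2 * n./2).+1 = j0 + n by lia.
  by rewrite column_costDn c0.
have := flips n./2.
have -> : (j0 + 2 * n./2).+1 = j0.+1 + n by lia.
rewrite heardDn; case odd_h: (odd n./2); last by lia.
by move=> eqC; have := proj2 (setP _ _) eqC ord0; rewrite inE; case: (_ \in _).
Qed.

Lemma bcost_ge : n <= bcost f.
Proof. by rewrite bcostE; apply: periodic_cost_ge column_costDn window_cost. Qed.

End Columns.

(** * Upper bound *)

Lemma bigminn_le (I : eqType) (s : seq I) (P : pred I) (F : I -> nat) z i :
  i \in s -> P i -> \big[minn/z]_(j <- s | P j) F j <= F i.
Proof.
elim: s => // k s IHs; rewrite inE big_cons => /orP[/eqP<- ->|si Pi].
  exact: geq_minl.
by case: ifP => _; rewrite ?IHs // geq_min IHs ?orbT.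
Qed.

Lemma bigminn_ge (I : finType) (P : pred I) (F : I -> nat) z m :
  m <= z -> (forall i, P i -> m <= F i) -> m <= \big[minn/z]_(i | P i) F i.
Proof.
move=> mz mF; apply: (big_ind (fun k => m <= k)) => // x y mx my.
by rewrite leq_min mx.
Qed.

(* A letter [(x, p)] stands for the column with the value [x] in row [p] and
   [0] in the other rows. *)
Definition letter_hears (l : nat * nat) d r :=
  [&& 0 < l.1, d <= l.1 &
    has (fun e => (r + (l.1 - d)) %% 6 == (l.2 + e) %% 6)
      (iota 0 (2 * (l.1 - d)).+1)].

(** A computable test that the five letters from position [s] cover the central column [s + 2]. *)
Definition window_hears (w : seq (nat * nat)) s :=
  all (fun r => has (fun i =>
    letter_hears (nth (0, 0) w (s + i)) ((2 - i) + (i - 2)) r) (iota 0 5))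
  (iota 0 6).

Definition block := [:: (2, 0); (0, 0); (2, 3); (0, 0)].

(* The broadcast on [C_6 x C_n] spelled by [m] copies of [block] followed by
   the tail [T]. *)
Section Construction.
Variables (m : nat) (T : seq (nat * nat)).
Let n := 4 * m + size T.

Definition letter j :=
  if j < 4 * m then nth (0, 0) block (j %% 4) else nth (0, 0) T (j - 4 * m).

Definition word_broadcast : broadcast2 ('I_6 * 'I_n)%type :=
  [ffun v : 'I_6 * 'I_n =>
    inord (if v.1 == (letter v.2).2 :> nat then (letter v.2).1 else 0)].

Hypothesis T_range : all (fun l : nat * nat => (l.1 < 3) && (l.2 < 6)) T.
Hypothesis T_size : 3 < size T.

Let n_gt1 : 1 < n. Proof. by rewrite /n; lia. Qed.

Lemma letter_range j : (letter j).1 < 3 /\ (letter j).2 < 6.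
Proof.
rewrite /letter; case: ifP => _.
  by case: (j %% 4) => [|[|[|[|[|k]]]]].
case: (ltnP (j - 4 * m) (size T)) => jT; last by rewrite nth_default.
by apply/andP/(allP T_range)/mem_nth.
Qed.

Lemma word_broadcastE (v : 'I_6 * 'I_n) : word_broadcast v =
  (if v.1 == (letter v.2).2 :> nat then (letter v.2).1 else 0) :> nat.
Proof. by rewrite ffunE inordK //; case: ifP => // _; case: (letter_range v.2). Qed.

Lemma word_cost : bcost word_broadcast = 4 * m + sumn [seq l.1 | l <- T].
Proof.
rewrite (bcostE n_gt1).
have -> : \sum_(j < n) column_cost n_gt1 word_broadcast j =
          \sum_(j < n) (letter j).1.
  apply: eq_bigr => j _; rewrite /column_cost modord_val.
  have [_ p6] := letter_range j.
  rewrite (bigD1 (Ordinal p6)) //= word_broadcastE /= eqxx big1 ?addn0 // => i ip.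
  rewrite word_broadcastE /= ifF //.
  by apply: contraNF ip => /eqP ip; apply/eqP/val_inj.
rewrite /n big_split_ord /=; congr (_ + _).
  rewrite (eq_bigr (fun j : 'I_(4 * m) => (nth (0, 0) block (j %% 4)).1)) => [|j _];
    last by rewrite /letter ltn_ord.
  rewrite -(big_mkord xpredT (fun j => (nth (0, 0) block (j %% 4)).1)).
  elim: (m) => [|k IHk]; first by rewrite muln0 big_geq.
  rewrite mulnSr addn4 !big_nat_recr //= IHk.
  have mE i : (4 * k + i) %% 4 = i %% 4 by rewrite mulnC modnMDl.
  rewrite -[(4 * k).+3]addn3 -[(4 * k).+2]addn2 -[(4 * k).+1]addn1 !mE modnMr /=.
  lia.
rewrite sumnE big_map (big_nth (0, 0)) big_mkord; apply: eq_bigr => j _.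
by rewrite /letter ifF ?addKn //; lia.
Qed.

(** Windows that overrun the tail are read as continuing into [block]; when [m = 0] the next lap
    starts with [T] itself. *)
Hypothesis T_begin : m = 0 -> take 4 T = block.
Hypothesis T_windows : all (window_hears (T ++ block)) (iota 0 (size T)).
Hypothesis block_windows : all (window_hears (block ++ T ++ block)) (iota 0 4).

(* The cyclic word, cut after the first four letters of its second lap. *)
Let unrolled k :=
  if k < 4 * m then nth (0, 0) block (k %% 4)
  else nth (0, 0) (T ++ block) (k - 4 * m).

Let letter_unrolled k : k < n + 4 -> letter (k %% n) = unrolled k.
Proof.
move=> kn; case: (ltnP k n) => [k_lt|k_ge].
  rewrite modn_small // /letter /unrolled; case: ltnP => // k4.
  by rewrite nth_cat ifT //; rewrite /n in k_lt; lia.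
have -> : k %% n = k - n.
  by rewrite -{1}(subnK k_ge) modnDr modn_small //; rewrite /n in k_ge kn *; lia.
have kb : k - n < 4 by lia.
rewrite /unrolled ifF; last by rewrite /n in k_ge; lia.
rewrite nth_cat ifF; last by rewrite /n in k_ge; lia.
have -> : k - 4 * m - size T = k - n by rewrite /n subnDA.
rewrite /letter; case: ltnP => km; first by rewrite modn_small.
have m0 : m = 0 by lia.
by rewrite -(T_begin m0) nth_take ?m0 // muln0 subn0.
Qed.

(** A window starts in the tail, lies within the blocks, or starts in the last block and may overrun
    it, so finitely many checks suffice. *)
Let unrolled_window j : j < n ->
  exists w s, window_hears w s /\
    forall i, i < 5 -> unrolled (j + i) = nth (0, 0) w (s + i).
Proof.
move=> jn; case: (ltnP j (4 * m)) => [jm|mj]; last first.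
  exists (T ++ block), (j - 4 * m); split.
    by apply: (allP T_windows); rewrite mem_iota; lia.
  move=> i _; rewrite /unrolled ifF; last lia.
  by congr nth; lia.
have b4 : j %% 4 < 4 by rewrite ltn_mod.
case: (ltnP (j + 4) (4 * m)) => jm4.
  exists (block ++ block), (j %% 4); split.
    by move: (j %% 4) b4 => [|[|[|[|]]]].
  move=> i i5; rewrite /unrolled ifT; last lia.
  rewrite -modnDml.
  by move: (j %% 4) b4 i5 => [|[|[|[|]]]] // _; case: i => [|[|[|[|[|]]]]].
exists (block ++ T ++ block), (j %% 4); split.
  by apply: (allP block_windows); rewrite mem_iota.
move=> i i5; rewrite /unrolled [RHS]nth_cat.
have jE := divn_eq j 4.
case: ltnP => ji.
  rewrite ifT; last by rewrite /=; lia.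
  by rewrite -modnDml modn_small //; lia.
rewrite ifF; last by rewrite /=; lia.
by congr nth; rewrite /=; lia.
Qed.

Lemma word_dominating :
  dominating2 (cart_rel (cycle_rel 6) (cycle_rel n)) word_broadcast.
Proof.
apply/(dominating_heardP n_gt1) => j r.
have jn : j %% n < n by rewrite ltn_mod; lia.
have [w [s [/allP/(_ (r : nat)) ws wE]]] := unrolled_window jn.
have rI : (r : nat) \in iota 0 6 by rewrite mem_iota /=.
have /hasP[i] := ws rI.
rewrite mem_iota /= => i5; rewrite -wE // => /and3P[l0 ld /hasP[e]].
rewrite mem_iota => /= ed /eqP E; exists i => //.
have lE : unrolled (j %% n + i) = letter ((j + i) %% n).
  by rewrite -letter_unrolled ?modnDml //; lia.
rewrite lE in l0 ld ed E.
have [_ p6] := letter_range ((j + i) %% n).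
apply/bigcupP; exists (Ordinal p6); rewrite word_broadcastE /= eqxx ?l0 //.
by apply/(ball_cycleP (isT : 0 < 6)); exists e.
Qed.

End Construction.

Lemma gamma_le_word n T : 3 < size T <= n -> n %% 4 = size T %% 4 ->
  all (fun l : nat * nat => (l.1 < 3) && (l.2 < 6)) T ->
  (n = size T -> take 4 T = block) ->
  all (window_hears (T ++ block)) (iota 0 (size T)) ->
  all (window_hears (block ++ T ++ block)) (iota 0 4) ->
  gamma_b2 (cart_rel (cycle_rel 6) (cycle_rel n))
    <= n - size T + sumn [seq l.1 | l <- T].
Proof.
case/andP=> T4 Tn nT T_range T_begin T_win T_win'.
have [m nE] : exists m, n = 4 * m + size T.
  exists ((n - size T) %/ 4); rewrite mulnC divnK ?subnK //.
  by rewrite -eqn_mod_dvd // nT.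
move: nE T_begin => -> T_begin; rewrite addnK -word_cost //.
apply: bigminn_le; first exact: mem_index_enum.
by apply: word_dominating => // m0; apply: T_begin; rewrite m0 muln0.
Qed.

Lemma gamma_C6_le n : 6 <= n ->
  gamma_b2 (cart_rel (cycle_rel 6) (cycle_rel n))
    <= n + (if n %% 4 == 0 then 0 else 1).
Proof.
move=> n6; have := ltn_pmod n (isT : 0 < 4).
(* The tails of 4, 5, 6, 7 columns cost 4, 6, 7, 8. As [n >= 6], the one not beginning with [block],
   of length 5, is never the whole word. *)
case nE: (n %% 4) => [|[|[|[|//]]]] _ /=.
- by apply: leq_trans (@gamma_le_word n block _ _ _ _ _ _) _ => //=; lia.
- by apply: leq_trans (@gamma_le_word n
    [:: (2, 0); (0, 0); (2, 3); (2, 3); (0, 0)] _ _ _ _ _ _) _ => //=; lia.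
- by apply: leq_trans (@gamma_le_word n
    [:: (2, 0); (0, 0); (2, 3); (0, 0); (2, 0); (1, 3)] _ _ _ _ _ _) _ => //=; lia.
- by apply: leq_trans (@gamma_le_word n
    [:: (2, 0); (0, 0); (2, 3); (0, 0); (2, 0); (0, 0); (2, 3)] _ _ _ _ _ _) _
    => //=; lia.
Qed.

Theorem theorem4p7 (n : nat) (hn : 6 <= n) :
  gamma_b2 (cart_rel (cycle_rel 6) (cycle_rel n)) =
  n + (if n %% 4 == 0 then 0 else 1).
Proof.
apply/eqP; rewrite eqn_leq gamma_C6_le //=.
have n_gt1 : 1 < n by lia.
apply: bigminn_ge => [|f dom_f].
  (* The default value of the minimum is [12 * n]. *)
  by rewrite card_prod !card_ord; case: ifP => _; lia.
have ge_n := bcost_ge n_gt1 dom_f; case: ifP => [_|/eqP n4]; first by rewrite addn0.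
rewrite addn1 ltn_neqAle ge_n andbT; apply/eqP => /esym /(bcost_eq n_gt1 dom_f).
exact: n4.
Qed.
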